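(* Let $(E,\mathscr T)$ be a stable locally $L^0$-convex module and $U$ a stable neighbourhood of $0$ in $E$. Then the polar $$U^\circ=\{f\in E^*:f(x)\le1\text{ for all }x\in U\}$$ is stable compact with respect to $\sigma_s(E^*,E)$.
   Context: $L^0$: real measurable functions on a probability space modulo a.e. equality, a.e. order, $L^0_{++}=\{r>0\text{ a.e.}\}$. $E$ stable: for each countable measurable partition $(A_k)$ and $(x_k)\subset E$ there is a unique $x=\sum_k1_{A_k}x_k$ with $1_{A_k}x=1_{A_k}x_k$. Nonempty subsets closed under concatenations are stable; for stable $Y_k$, $\sum_k1_{A_k}Y_k=\{\sum_k1_{A_k}y_k:y_k\in Y_k\}$. An $L^0$-seminorm is $p:E\to L^0_+$, $p(rx)=|r|p(x)$, $p(x+y)\le p(x)+p(y)$; a collection $\mathscr P$ is stable if closed under $\sum_k1_{A_k}p_k$, separated if $\sup_pp(x)=0\Rightarrow x=0$. $\mathscr N\subset\mathscr P$ is stable finite if $\mathscr N=\{\sum_k1_{A_k}q_k:q_k\in\mathrm{st}(\mathscr N_k)\}$ with $\mathscr N_k\subset\mathscr P$ finite, $\mathrm{st}(\mathscr N_k)$ the concatenations of elements of $\mathscr N_k$. For a stable family $\mathscr P$, $\mathscr T_s(\mathscr P)$ is generated by $\{y:\sup_{p\in\mathscr N}p(x-y)<r\}$, $r\in L^0_{++}$, $\mathscr N$ stable finite. A stable locally $L^0$-convex module is stable $E$ with $\mathscr T=\mathscr T_s(\mathscr P)$ for a stable separated $\mathscr P$. $E^*$ is the stable $L^0$-module of continuous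 $L^0$-linear $f:E\to L^0$ ($L^0$ with base $\{s:|s-t|<r\}$). $\sigma_s(E^*,E)$ is the topology $\mathscr T_s$ on $E^*$ induced by the stable family of seminorms $\{f\mapsto|f(x)|:x\in E\}$. A filter is stable if it has a filter base which is a stable collection of stable sets; a stable set is stable compact if every stable filter on it has a cluster point in it. *)

(* Defs.v *)
From HB Require Import structures.
From mathcomp Require Import all_boot all_order all_algebra.
From mathcomp Require Import all_classical all_reals all_analysis.
Set Implicit Arguments. Unset Strict Implicit. Unset Printing Implicit Defensive.
Import Order.TTheory GRing.Theory Num.Theory.
Local Open Scope classical_set_scope.
Local Open Scope ring_scope.

Fixpoint inseq (A : Type) (a : A) (l : seq A) : Prop :=
  match l with [::] => False | b :: l' => b = a \/ inseq a l' end.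

Section L0Space.
Context (d : measure_display) (T : measurableType d) (R : realType)
        (P : probability T R).

Definition clsof (f : T -> R) : set (T -> R) :=
  [set g | measurable_fun setT g /\ f = g %[ae P]].

Record L0 := MkL0 {
  L0cls : set (T -> R);
  L0ok : exists f, measurable_fun setT f /\ L0cls = clsof f }.

Definition rep (r : L0) : T -> R := projT1 (cid (L0ok r)).

Definition L0of_meas (f : T -> R) (hf : measurable_fun setT f) : L0 :=
  @MkL0 (clsof f) (ex_intro _ f (conj hf erefl)).

(** class of f (only meaningful for measurable f; 0 otherwise) *)
Definition mkL0 (f : T -> R) : L0 :=
  match pselect (measurable_fun setT f) with
  | left hf => L0of_meas hf
  | right _ => L0of_meas (@measurable_cst _ _ T R setT (0:R))
  end.

Definition L0cst (c : R) : L0 := mkL0 (cst c).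
Definition L0zero : L0 := L0cst 0.
Definition L0one : L0 := L0cst 1.
Definition L0add (r s : L0) : L0 := mkL0 (rep r \+ rep s).
Definition L0mul (r s : L0) : L0 := mkL0 (rep r \* rep s).
Definition L0opp (r : L0) : L0 := mkL0 (\- rep r).
Definition L0sub (r s : L0) : L0 := L0add r (L0opp s).
Definition L0abs (r : L0) : L0 := mkL0 (fun w => `|rep r w|).
Definition L0ind (A : set T) : L0 := mkL0 (\1_A).

Definition L0le (r s : L0) : Prop := {ae P, forall w, rep r w <= rep s w}.
Definition L0lt (r s : L0) : Prop := {ae P, forall w, rep r w < rep s w}.
Definition L0pos (r : L0) : Prop := L0lt L0zero r.

Definition L0lub (S : set L0) (s : L0) : Prop :=
  (forall t, S t -> L0le t s) /\
  (forall u, (forall t, S t -> L0le t u) -> L0le s u).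

Definition mpartition (A : nat -> set T) : Prop :=
  (forall k, measurable (A k)) /\
  (forall i j, i <> j -> A i `&` A j = set0) /\
  \bigcup_k A k = setT.

(** s = sum_k 1_{A_k} r_k in L^0 *)
Definition concatL0 (A : nat -> set T) (rs : nat -> L0) (s : L0) : Prop :=
  forall k, L0mul (L0ind (A k)) s = L0mul (L0ind (A k)) (rs k).

Definition concat_fun (V : Type) (A : nat -> set T) (qs : nat -> V -> L0)
  (q : V -> L0) : Prop :=
  forall v, concatL0 A (fun k => qs k v) (q v).

Section Stable.
Variables (V : Type) (conc : (nat -> set T) -> (nat -> V) -> V -> Prop).

Definition stable_set (Y : set V) : Prop :=
  (exists y, Y y) /\
  forall A ys, mpartition A -> (forall k, Y (ys k)) ->
    forall x, conc A ys x -> Y x.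

Definition set_concat (A : nat -> set T) (Ys : nat -> set V) : set V :=
  [set x | exists ys, (forall k, Ys k (ys k)) /\ conc A ys x].

Definition stable_collection (B : set (set V)) : Prop :=
  (exists Y, B Y) /\ (forall Y, B Y -> stable_set Y) /\
  forall A Ys, mpartition A -> (forall k, B (Ys k)) -> B (set_concat A Ys).

Definition filter_on (X : set V) (F : set (set V)) : Prop :=
  (forall G, F G -> G `<=` X) /\ F X /\ ~ F set0 /\
  (forall G H, F G -> F H -> F (G `&` H)) /\
  (forall G H, F G -> G `<=` H -> H `<=` X -> F H).

Definition stable_filter (F : set (set V)) : Prop :=
  exists B, B `<=` F /\ (forall G, F G -> exists2 Y, B Y & Y `<=` G) /\
            stable_collection B.

Definition cluster_point (nbhd : V -> set V -> Prop) (F : set (set V)) (x : V) :=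
  forall G W, F G -> nbhd x W -> exists y, G y /\ W y.

Definition stable_compact (nbhd : V -> set V -> Prop) (K : set V) : Prop :=
  stable_set K /\
  forall F, filter_on K F -> stable_filter F ->
    exists x, K x /\ cluster_point nbhd F x.

Variable (sub : V -> V -> V).

Definition L0st (Nk : seq (V -> L0)) (q : V -> L0) : Prop :=
  exists B, mpartition B /\
  exists ns : nat -> V -> L0, (forall j, inseq (ns j) Nk) /\ concat_fun B ns q.

Definition stable_finite (Pfam : set (V -> L0)) (N : set (V -> L0)) : Prop :=
  exists A, mpartition A /\
  exists Ns : nat -> seq (V -> L0),
    (forall k, Ns k <> [::] /\ forall q, inseq q (Ns k) -> Pfam q) /\
    N = [set q | exists qs, (forall k, L0st (Ns k) (qs k)) /\ concat_fun A qs q].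

Definition sball (N : set (V -> L0)) (x : V) (r : L0) : set V :=
  [set y | exists s, L0lub [set p (sub x y) | p in N] s /\ L0lt s r].

(** neighbourhoods in the topology generated by the sets sball N x r,
    r in L^0_{++}, N stable finite: W contains a finite intersection of
    generating sets containing z *)
Definition Ts_nbhd (Pfam : set (V -> L0)) (z : V) (W : set V) : Prop :=
  exists n (xs : 'I_n -> V) (Ns : 'I_n -> set (V -> L0)) (rs : 'I_n -> L0),
    (forall i, stable_finite Pfam (Ns i) /\ L0pos (rs i) /\
               sball (Ns i) (xs i) (rs i) z) /\
    (forall y, (forall i, sball (Ns i) (xs i) (rs i) y) -> W y).

End Stable.

Section Module.
Variables (E : zmodType) (scale : L0 -> E -> E).

Definition L0module : Prop :=
  (forall r s x, scale (L0add r s) x = scale r x + scale s x) /\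
  (forall r x y, scale r (x + y) = scale r x + scale r y) /\
  (forall r s x, scale (L0mul r s) x = scale r (scale s x)) /\
  (forall x, scale L0one x = x).

(** x = sum_k 1_{A_k} x_k *)
Definition concatE (A : nat -> set T) (xs : nat -> E) (x : E) : Prop :=
  forall k, scale (L0ind (A k)) x = scale (L0ind (A k)) (xs k).

Definition stable_module : Prop :=
  forall A (xs : nat -> E), mpartition A -> exists! x, concatE A xs x.

Definition L0seminorm (p : E -> L0) : Prop :=
  (forall x, L0le L0zero (p x)) /\
  (forall r x, p (scale r x) = L0mul (L0abs r) (p x)) /\
  (forall x y, L0le (p (x + y)) (L0add (p x) (p y))).

Definition L0stable_family (Pfam : set (E -> L0)) : Prop :=
  forall A ps, mpartition A -> (forall k, Pfam (ps k)) ->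
    exists p, Pfam p /\ concat_fun A ps p.

Definition L0separated (Pfam : set (E -> L0)) : Prop :=
  forall x, L0lub [set p x | p in Pfam] L0zero -> x = 0.

Definition Ts_nbhdE (Pfam : set (E -> L0)) : E -> set E -> Prop :=
  Ts_nbhd (fun x y => x - y) Pfam.

(** topology of L^0 with base { s : |s - t| < r }, r in L^0_{++} *)
Definition nbhdL0 (t : L0) (W : set L0) : Prop :=
  exists t' r, L0pos r /\ L0lt (L0abs (L0sub t t')) r /\
    [set s | L0lt (L0abs (L0sub s t')) r] `<=` W.

Definition L0dual (Pfam : set (E -> L0)) (f : E -> L0) : Prop :=
  (forall x y, f (x + y) = L0add (f x) (f y)) /\
  (forall r x, f (scale r x) = L0mul r (f x)) /\
  (forall x W, nbhdL0 (f x) W -> Ts_nbhdE Pfam x (f @^-1` W)).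

Definition weak_family : set ((E -> L0) -> L0) :=
  [set q | exists x, q = fun f => L0abs (f x)].

Definition nbhd_sigma : (E -> L0) -> set (E -> L0) -> Prop :=
  Ts_nbhd (fun f g x => L0sub (f x) (g x)) weak_family.

Definition L0polar (Pfam : set (E -> L0)) (U : set E) : set (E -> L0) :=
  [set f | L0dual Pfam f /\ forall x, U x -> L0le (f x) L0one].

End Module.
End L0Space.

(* Main.v *)
(* A linear functional that is at most 1 on [U] is automatically continuous and,
   [U] being absorbing, bounded pointwise by an element of L^0 depending on the
   point only.  Given a stable filter on the polar, apply Zorn's lemma to the
   graphs [G] of partial functions to which the filter is adherent: every set Y
   of the base, every finite part of [G] and every r in L^0_{++} admit some y in
   Y that is r-close to [G] on that part.  This condition has finite character.
   A graph extends to a new point x by the limit superior of y(x), an essential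
   infimum of essential suprema; a maximizing sequence glued along a countable
   partition stays in the stable set Y, so the limit superior is approximated by
   elements of Y.  A maximal graph is therefore a total function; closeness at
   finitely many points makes it linear and at most 1 on [U], and gluing once more
   upgrades finite sets of seminorms to stable finite ones. *)

Require Import Defs.
From HB Require Import structures.
From mathcomp Require Import all_boot all_order all_algebra.
From mathcomp Require Import all_classical all_reals all_analysis.
From mathcomp Require Import measurable_realfun.
From mathcomp Require Import lra.
Set Implicit Arguments.
Unset Strict Implicit.
Unset Printing Implicit Defensive.
Import Order.TTheory GRing.Theory Num.Theory.
Local Open Scope classical_set_scope.
Local Open Scope ring_scope.

(** Puts an almost-everywhere fact in front of the goal under the same quantifier, so that one [aeW]
    finishes pointwise; the fact used last becomes the first premise. *)
Ltac ae_use H := refine (filter_app _ _ H).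

(** * Almost-everywhere calculus, gluing and essential suprema in L^0 *)

Section L0Calculus.
Context {d : measure_display} {T : measurableType d} {R : realType}
        {P : probability T R}.
Implicit Types (r s t u : L0 P) (A B D : nat -> set T).

Lemma ae_forall_countable (I : countType) (Q : I -> T -> Prop) :
  (forall i, \forall w \ae P, Q i w) -> \forall w \ae P, forall i, Q i w.
Proof.
move=> h.
have h' n : \forall w \ae P, if unpickle n is Some i then Q i w else True.
  by case: (unpickle n) => [i|]; [exact: h|exact: aeW].
ae_use (ae_foralln h'); apply: aeW => w hw i.
by have := hw (pickle i); rewrite pickleK.
Qed.

Lemma measurable_rep r : measurable_fun setT (rep r).
Proof. by rewrite /rep; case: cid => f []. Qed.
Hint Resolve measurable_rep : core.

Lemma L0clsE r : L0cls r = clsof P (rep r).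
Proof. by rewrite /rep; case: cid => f []. Qed.

Lemma rep_mkL0 (f : T -> R) : measurable_fun setT f ->
  \forall w \ae P, rep (mkL0 P f) w = f w.
Proof.
move=> mf; have h : clsof P f f by split => //; exact: aeW.
have : L0cls (mkL0 P f) f by rewrite /mkL0; case: pselect.
rewrite L0clsE => -[_ H]; ae_use H; apply: aeW => w; exact.
Qed.

(** An element is a whole equivalence class packed with an existence proof: representatives equal
    a.e. span the same class, and proof irrelevance identifies the records. *)
Lemma L0eqP r s : (\forall w \ae P, rep r w = rep s w) -> r = s.
Proof.
move=> h; have : L0cls r = L0cls s.
  rewrite !L0clsE; apply/seteqP; split=> g [mg H]; split=> //;
  by ae_use H; ae_use h; apply: aeW => w e1 e2 _; rewrite -e2// e1.
case: r s {h} => [c hc] [c' hc'] /= e; rewrite -e in hc' *.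
by rewrite (Prop_irrelevance hc hc').
Qed.

Lemma rep_add r s : \forall w \ae P, rep (L0add r s) w = rep r w + rep s w.
Proof. by apply: rep_mkL0; exact: measurable_funD. Qed.

Lemma rep_mul r s : \forall w \ae P, rep (L0mul r s) w = rep r w * rep s w.
Proof. by apply: rep_mkL0; exact: measurable_funM. Qed.

Lemma rep_opp r : \forall w \ae P, rep (L0opp r) w = - rep r w.
Proof. by apply: rep_mkL0; exact: measurable_funN. Qed.

Lemma rep_sub r s : \forall w \ae P, rep (L0sub r s) w = rep r w - rep s w.
Proof.
ae_use (rep_add r (L0opp s)); ae_use (rep_opp s).
by apply: aeW => w e1 e2; rewrite e2 e1.
Qed.

Lemma rep_abs r : \forall w \ae P, rep (L0abs r) w = `|rep r w|.
Proof. by apply: rep_mkL0; exact: measurableT_comp. Qed.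

Lemma rep_cst (c : R) : \forall w \ae P, rep (L0cst P c) w = c.
Proof. exact: rep_mkL0. Qed.

Lemma rep_ind (A : set T) : measurable A ->
  \forall w \ae P, rep (L0ind P A) w = \1_A w.
Proof. by move=> mA; apply: rep_mkL0; exact: measurable_indic. Qed.

Lemma L0pos_rep r : L0pos r <-> \forall w \ae P, 0 < rep r w.
Proof.
by split=> H; ae_use H; ae_use (rep_cst 0); apply: aeW => w e; rewrite e.
Qed.

Lemma L0le1_rep r : L0le r (L0one P) <-> \forall w \ae P, rep r w <= 1.
Proof.
by split=> H; ae_use H; ae_use (rep_cst 1); apply: aeW => w e; rewrite e.
Qed.

(** Replaces the algebraic definition through indicators by equality of representatives a.e. on each
    piece, the form in which gluing is used below. *)
Lemma concatL0P A (rs : nat -> L0 P) s : mpartition A ->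
  concatL0 A rs s <->
  forall k, \forall w \ae P, A k w -> rep s w = rep (rs k) w.
Proof.
move=> [mA _]; split=> h k.
  have := rep_mul (L0ind P (A k)) s; rewrite (h k) => H.
  ae_use H; ae_use (rep_mul (L0ind P (A k)) (rs k)); ae_use (rep_ind (mA k)).
  apply: aeW => w e1 -> e2 Aw; move: e2.
  by rewrite e1 indicE mem_set// !mul1r.
apply: L0eqP; ae_use (h k); ae_use (rep_mul (L0ind P (A k)) s).
ae_use (rep_mul (L0ind P (A k)) (rs k)); ae_use (rep_ind (mA k)).
apply: aeW => w e1 -> -> h'; rewrite e1 indicE.
by have [/set_mem/h' ->|_] := boolP (w \in A k); rewrite ?mul0r.
Qed.

Lemma mpartition_cover A w : mpartition A -> exists k, A k w.
Proof. by case=> _ [_ e]; have : setT w by []; rewrite -e => -[k _]; exists k. Qed.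

Lemma mpartition_inj A j k w : mpartition A -> A j w -> A k w -> j = k.
Proof.
move=> [_ [h _]] Aj Ak; apply: contrapT => /h e.
by have : (A j `&` A k) w by []; rewrite e.
Qed.

(** Every point lies in exactly one piece, so the representatives glue to a function, measurable
    because it is measurable on each of countably many measurable pieces. *)
Lemma concatL0_ex A (rs : nat -> L0 P) : mpartition A -> exists s, concatL0 A rs s.
Proof.
move=> hA; have [mA [dA cA]] := hA.
have [kk hk] := choice (fun w => mpartition_cover w hA).
pose f w := rep (rs (kk w)) w.
have fE k w : A k w -> f w = rep (rs k) w.
  by move=> Aw; rewrite /f (mpartition_inj hA (hk w) Aw).
have mf : measurable_fun setT f.
  rewrite -cA; apply/(measurable_fun_bigcup _ mA) => k.
  apply: (eq_measurable_fun (rep (rs k))) => [w /set_mem/fE//|].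
  exact: measurable_funS (measurable_rep _).
exists (mkL0 P f); apply/concatL0P => // k; ae_use (rep_mkL0 mf).
by apply: aeW => w -> /fE.
Qed.

Lemma concat_fun_ex (V : Type) A (qs : nat -> V -> L0 P) : mpartition A ->
  exists q, concat_fun A qs q.
Proof.
move=> hA; have [q hq] := choice (fun v => concatL0_ex (fun k => qs k v) hA).
by exists q.
Qed.

Lemma mpartition_of_ae_cover D : (forall k, measurable (D k)) ->
  (\forall w \ae P, exists k, D k w) ->
  exists A, mpartition A /\ forall k, \forall w \ae P, A k w -> D k w.
Proof.
move=> mD cD; have mU : measurable (\bigcup_k D k) by exact: bigcupT_measurable.
(* Adding the uncovered null set to every [D k] makes the cover total; [seqDU] then makes it
   disjoint. *)
pose D' k := D k `|` ~` \bigcup_k D k; exists (seqDU D'); split; [split; [|split]|].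
- by apply: seqDU_measurable => k; apply: measurableU => //; exact: measurableC.
- move=> i j ij; apply: contrapT => /eqP/set0P hI; apply: ij.
  exact: (trivIset_seqDU D').
- rewrite -seqDU_bigcup_eq; apply/seteqP; split=> // w _.
  have [[k _ Dk]|nD] := pselect ((\bigcup_k D k) w); first by exists k => //; left.
  by exists 0%N => //; right.
- move=> k; ae_use cD; apply: aeW => w [j Dj] [[//|nD] _].
  by case: nD; exists j.
Qed.

Lemma measurable_ltr (f g : T -> R) : measurable_fun setT f ->
  measurable_fun setT g -> measurable [set w | f w < g w].
Proof.
move=> mf mg; have := measurable_fun_ltr mf mg measurableT (Y:=[set true]).
rewrite setTI => h; exact: h.
Qed.

(** Exhaustion: some sequence in [S] has a union of the largest possible probability. Adjoining one
    more member of [S] cannot increase it, so that member is covered up to a null set. *)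
Lemma countable_ess_cover (S : set (set T)) : S !=set0 ->
  (forall A : set T, S A -> measurable A) ->
  exists a : nat -> set T, (forall k, S (a k)) /\
    forall A : set T, S A -> \forall w \ae P, A w -> exists k, a k w.
Proof.
move=> [A0 SA0] mS.
pose M := [set P (\bigcup_k a k) | a in [set a : nat -> set T | forall k, S (a k)]].
have mU (a : nat -> set T) : (forall k, S (a k)) -> measurable (\bigcup_k a k).
  by move=> Sa; apply: bigcupT_measurable => k; exact: mS.
have M1 : (ereal_sup M <= 1)%E.
  by apply: ge_ereal_sup => _ [a Sa <-]; apply: probability_le1; exact: mU.
have M0 : (0 <= ereal_sup M)%E.
  apply: (@le_trans _ _ (P (\bigcup_(k in setT) A0))) => //.
  by apply: ereal_sup_ubound; exists (fun=> A0).
have Mf : ereal_sup M \is a fin_num.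
  rewrite ge0_fin_numE//; exact: le_lt_trans M1 (ltry _).
have /choice[a ha] : forall n : nat, exists a : nat -> set T, (forall k, S (a k)) /\
    (ereal_sup M - (n.+1%:R^-1)%:E < P (\bigcup_k a k))%E.
  move=> n; have e0 : 0 < n.+1%:R^-1 :> R by rewrite invr_gt0.
  by have [_ [a Sa <-] h] := ub_ereal_sup_adherent e0 Mf; exists a.
(* Merges the near-optimal sequences for all n into one by coding pairs; numbers that code no pair
   receive [A0]. *)
pose b m := if unpickle m is Some nk then a nk.1 nk.2 else A0.
have Sb k : S (b k).
  by rewrite /b; case: unpickle => [[n j]|//]; case: (ha n).
exists b; split=> // A SA.
have ub : (ereal_sup M <= P (\bigcup_k b k))%E.
  apply/lee_addgt0Pr => e e0.
  have [n hn] := ltr_add_invr e0; rewrite add0r in hn.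
  rewrite -leeBlDr//; apply: (@le_trans _ _ (ereal_sup M - (n.+1%:R^-1)%:E)%E).
    by apply: leeD => //; rewrite leeN2 lee_fin ltW.
  have [Sa /ltW h] := ha n; apply: (le_trans h).
  apply: le_measure; rewrite ?inE; [exact: mU|exact: mU|].
  move=> w [k _ akw]; exists (pickle (n, k)) => //.
  by rewrite /b pickleK.
pose c k := if k is k'.+1 then b k' else A.
have Sc k : S (c k) by case: k.
have cE : \bigcup_k c k = A `|` \bigcup_k b k.
  apply/seteqP; split=> w; first by case=> -[|k] _ h; [left|right; exists k].
  by case=> [h|[k _ h]]; [exists 0%N|exists k.+1].
have le : (P (A `|` \bigcup_k b k) <= P (\bigcup_k b k))%E.
  by rewrite -cE (le_trans _ ub)//; apply: ereal_sup_ubound; exists c.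
have mD : measurable (A `\` \bigcup_k b k) by apply: measurableD; [exact: mS|exact: mU].
have z : P (A `\` \bigcup_k b k) = 0.
  have fb : P (\bigcup_k b k) \is a fin_num by apply: fin_num_measure; exact: mU.
  apply/eqP; rewrite -measure_le0 -(leeD2rE _ _ fb) add0e.
  rewrite -measureU//; last by rewrite setDKI.
    by rewrite setUDl setDv setD0.
  exact: mU.
exists (A `\` \bigcup_k b k); split=> // w /= h; apply: contrapT => h'; apply: h => Aw.
by apply: contrapT => hn; apply: h'; split=> // -[k _ bk]; apply: hn; exists k.
Qed.

(** Existence of essential suprema. For each rational q countably many members of [S] cover all
    superlevel sets at q up to null sets; the pointwise supremum of all these members is the least
    upper bound. Sorting the points by an index that comes within [r] of it gives the partition. *)
Lemma L0lub_approx (S : set (L0 P)) u : S !=set0 ->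
  (forall t, S t -> L0le t u) ->
  exists s, L0lub S s /\ forall r, L0pos r -> exists A (ts : nat -> L0 P),
    [/\ mpartition A, forall k, S (ts k) &
     forall k, \forall w \ae P, A k w -> rep s w - rep r w < rep (ts k) w].
Proof.
move=> [t0 St0] Su.
have /choice[a ha] : forall q : rat, exists a : nat -> L0 P, (forall k, S (a k)) /\
    forall t, S t -> \forall w \ae P, ratr q < rep t w ->
      exists k, ratr q < rep (a k) w.
  move=> q; pose SS := [set [set w | ratr q < rep t w] | t in S].
  have [|A [t St <-]|a [Sa ha]] := @countable_ess_cover SS.
  - by exists [set w | ratr q < rep t0 w]; exists t0.
  - exact: measurable_ltr.
  have /choice[b hb] : forall k, exists t, S t /\ a k = [set w | ratr q < rep t w].
    by move=> k; have [t St <-] := Sa k; exists t.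
  exists b; split=> [k|t St]; first by case: (hb k).
  have H : SS [set w | ratr q < rep t w] by exists t.
  ae_use (ha _ H); apply: aeW => w h /h[k]; have [_ ->] := hb k => ?; by exists k.
pose b m := if unpickle m is Some qk then a qk.1 qk.2 else t0.
have Sb k : S (b k).
  by rewrite /b; case: unpickle => [[q j]|//]; case: (ha q).
have bP t : S t -> \forall w \ae P, forall q, ratr q < rep t w ->
    exists k, ratr q < rep (b k) w.
  move=> St; apply: ae_forall_countable => q; have [_ h] := ha q.
  ae_use (h _ St); apply: aeW => w h' /h'[k hk].
  by exists (pickle (q, k)); rewrite /b pickleK.
(* Truncation at [u] makes the pointwise supremum finite everywhere and changes each [b k] only on a
   null set. *)
pose h k w := Num.min (rep (b k) w) (rep u w).
have hub w : has_ubound (range (h ^~ w)).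
  by exists (rep u w) => _ [k _ <-]; rewrite /h ge_min lexx orbT.
have mh : measurable_fun setT (fun w => sups (h ^~ w) 0).
  apply: measurable_fun_sups => // m; exact: measurable_minr.
have sE w : sups (h ^~ w) 0 = sup (range (h ^~ w)).
  by rewrite /sups; congr (sup _); apply/seteqP; split=> _ [k _ <-]; exists k.
have hE : \forall w \ae P, forall k, h k w = rep (b k) w.
  apply: ae_foralln => k; ae_use (Su _ (Sb k)); apply: aeW => w le.
  exact/min_idPl.
exists (mkL0 P (fun w => sups (h ^~ w) 0)); split; first split.
- move=> t St; ae_use (bP t St); ae_use hE; ae_use (rep_mkL0 mh).
  apply: aeW => w -> e H; rewrite sE leNgt; apply/negP => lt.
  have [q] := rat_in_itvoo lt; rewrite in_itv/= => /andP[l1 /H[k hk]].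
  have : h k w <= sup (range (h ^~ w)) by apply: ub_le_sup => //; exists k.
  by rewrite e leNgt (lt_trans l1 hk).
- move=> v Sv; have bv : \forall w \ae P, forall k, rep (b k) w <= rep v w.
    by apply: ae_foralln => k; exact: Sv.
  ae_use bv; ae_use hE; ae_use (rep_mkL0 mh); apply: aeW => w -> e H.
  by rewrite sE; apply: ge_sup; [exists (h 0%N w); exists 0%N|move=> _ [k _ <-]; rewrite e].
move=> r /L0pos_rep rp.
set s := mkL0 _ _.
have [||A [hA AD]] := @mpartition_of_ae_cover
    (fun k => [set w | rep s w - rep r w < rep (b k) w]).
- by move=> k; apply: measurable_ltr => //; exact: measurable_funB.
- ae_use rp; ae_use hE; ae_use (rep_mkL0 mh); apply: aeW => w e1 e r0.
  have [|_ [k _ <-]] := sup_adherent r0 (E:=range (h ^~ w)).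
    by split=> //; exists (h 0%N w); exists 0%N.
  by rewrite e => lt; exists k; rewrite /= /s e1 sE.
by exists A, b.
Qed.


Lemma L0le_eps r s :
  (forall e : R, 0 < e -> \forall w \ae P, rep r w <= rep s w + e) -> L0le r s.
Proof.
move=> h.
have H : \forall w \ae P, forall n, rep r w <= rep s w + n.+1%:R^-1.
  by apply: ae_foralln => n; apply: h; rewrite invr_gt0.
ae_use H; apply: aeW => w {}H; apply/ler_addgt0Pr => e e0.
have [n] := ltr_add_invr e0; rewrite add0r => /ltW hn.
by rewrite (le_trans (H n))// lerD2l.
Qed.

Lemma L0eq_eps r s :
  (forall e : R, 0 < e -> \forall w \ae P, `|rep r w - rep s w| <= e) -> r = s.
Proof.
move=> h.
have h1 : L0le r s.
  apply: L0le_eps => e /h H; ae_use H; apply: aeW => w.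
  by rewrite ler_norml => /andP[]; lra.
have h2 : L0le s r.
  apply: L0le_eps => e /h H; ae_use H; apply: aeW => w.
  by rewrite ler_norml => /andP[]; lra.
by apply: L0eqP; ae_use h1; ae_use h2; apply: aeW => w ? ?; apply/eqP; rewrite eq_le; apply/andP.
Qed.

Lemma L0half_pos r : L0pos r -> exists s, [/\ L0pos s, L0lt s r &
  \forall w \ae P, rep s w = rep r w / 2].
Proof.
move=> /L0pos_rep r0; exists (L0mul r (L0cst P 2^-1)).
have H : \forall w \ae P, rep (L0mul r (L0cst P 2^-1)) w = rep r w / 2.
  ae_use (rep_mul r (L0cst P 2^-1)); ae_use (rep_cst (2^-1)).
  by apply: aeW => w e1 e2; rewrite e2 e1.
split=> //.
  by apply/L0pos_rep; ae_use H; ae_use r0; apply: aeW => w ? ->; lra.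
by ae_use H; ae_use r0; apply: aeW => w ? ->; lra.
Qed.

Lemma L0inv_ex r : L0pos r -> exists s, L0pos s /\
  \forall w \ae P, rep s w = (rep r w)^-1.
Proof.
(* The power with exponent -1 is measurable and equals the inverse wherever [rep r] is positive. *)
move=> /L0pos_rep r0; exists (mkL0 P (fun w => powR (rep r w) (-1))).
have m : measurable_fun setT (fun w => powR (rep r w) (-1)).
  by apply: (measurableT_comp (measurable_powR (-1))).
have H : \forall w \ae P,
    rep (mkL0 P (fun w => powR (rep r w) (-1))) w = (rep r w)^-1.
  by ae_use (rep_mkL0 m); ae_use r0; apply: aeW => w ? ->; rewrite powR_inv1// ltW.
by split=> //; apply/L0pos_rep; ae_use H; ae_use r0; apply: aeW => w ? ->; rewrite invr_gt0.
Qed.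

Lemma L0min_ex r s : L0pos r -> L0pos s ->
  exists t, [/\ L0pos t, L0le t r & L0le t s].
Proof.
move=> /L0pos_rep r0 /L0pos_rep s0.
have m : measurable_fun setT (rep r \min rep s) by exact: measurable_minr.
exists (mkL0 P (rep r \min rep s)); split.
- apply/L0pos_rep; ae_use r0; ae_use s0; ae_use (rep_mkL0 m).
  by apply: aeW => w -> ? ?; rewrite lt_min; apply/andP.
- by ae_use (rep_mkL0 m); apply: aeW => w ->; rewrite ge_min lexx.
- by ae_use (rep_mkL0 m); apply: aeW => w ->; rewrite ge_min lexx orbT.
Qed.

Lemma L0min_fin_ex n (es : 'I_n -> L0 P) : (forall i, L0pos (es i)) ->
  exists e, L0pos e /\ forall i, L0le e (es i).
Proof.
elim: n es => [|n IH] es h.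
  exists (L0one P); split=> [|[]//].
  by apply/L0pos_rep; ae_use (rep_cst 1); apply: aeW => w ->.
have [e [e0 he]] := IH (fun i => es (lift ord0 i)) (fun i => h _).
have [t [t0 t1 t2]] := L0min_ex (h ord0) e0.
exists t; split=> // i; case: (unliftP ord0 i) => [j|] ->//.
by ae_use t2; ae_use (he j); apply: aeW => w a b; exact: le_trans b a.
Qed.

End L0Calculus.

Lemma inseq_cat (X : Type) (x : X) l l' : inseq x (l ++ l') <-> inseq x l \/ inseq x l'.
Proof.
elim: l => [|a l IH] /=; first by split=> [|[]//]; right.
by rewrite IH; split; [move=> [|[]]|move=> [[]|]]; auto.
Qed.

(** * Stable finite sets of seminorms and their balls *)

Section StableFamilies.
Context {d : measure_display} {T : measurableType d} {R : realType}
        {P : probability T R} {V : Type} (sub : V -> V -> V).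
Implicit Types (A : nat -> set T) (Ns : nat -> seq (V -> L0 P)).

(** At almost every point a concatenation takes its values at [x], [y] and [z] from one and the same
    generator, so it inherits any pointwise relation among them. Three arguments serve the triangle
    inequality. *)
Lemma stable_finite_transfer A Ns (Q : T -> R -> R -> R -> Prop) x y z :
  mpartition A ->
  (forall k p, inseq p (Ns k) -> \forall w \ae P, A k w ->
     Q w (rep (p x) w) (rep (p y) w) (rep (p z) w)) ->
  forall q qs, (forall k, L0st (Ns k) (qs k)) -> concat_fun A qs q ->
  \forall w \ae P, Q w (rep (q x) w) (rep (q y) w) (rep (q z) w).
Proof.
move=> hA hQ q qs /choice[B hB] hq.
have {}hB k : mpartition (B k) /\ exists ns : nat -> V -> L0 P,
  (forall j, inseq (ns j) (Ns k)) /\ concat_fun (B k) ns (qs k) by exact: hB.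
have /choice[ns hns] := fun k => (hB k).2.
have H1 v : \forall w \ae P, forall k, A k w -> rep (q v) w = rep (qs k v) w.
  by apply: ae_foralln; apply/(concatL0P _ _ hA); exact: hq.
have H2 v : \forall w \ae P, forall k j, B k j w ->
    rep (qs k v) w = rep (ns k j v) w.
  by apply: ae_foralln => k; apply: ae_foralln;
     apply/(concatL0P _ _ (hB k).1); exact: (hns k).2.
have H3 : \forall w \ae P, forall k j, A k w ->
    Q w (rep (ns k j x) w) (rep (ns k j y) w) (rep (ns k j z) w).
  by apply: ae_foralln => k; apply: ae_foralln => j; apply: hQ; exact: (hns k).1.
ae_use H3; ae_use (H2 x); ae_use (H2 y); ae_use (H2 z).
ae_use (H1 x); ae_use (H1 y); ae_use (H1 z); apply: aeW => w z1 y1 x1 z2 y2 x2 h.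
have [k Ak] := mpartition_cover w hA; have [j Bj] := mpartition_cover w (hB k).1.
rewrite (x1 k)// (y1 k)// (z1 k)// (x2 k j)// (y2 k j)// (z2 k j)//; exact: h.
Qed.

Lemma stable_finite_ind (Pfam N : set (V -> L0 P))
    (Q : T -> R -> R -> R -> Prop) x y z : stable_finite Pfam N ->
  (forall p, Pfam p -> \forall w \ae P,
     Q w (rep (p x) w) (rep (p y) w) (rep (p z) w)) ->
  forall q, N q -> \forall w \ae P, Q w (rep (q x) w) (rep (q y) w) (rep (q z) w).
Proof.
move=> [A [hA [Ns [hN ->]]]] h q [qs [h1 h2]].
apply: (stable_finite_transfer hA _ h1 h2) => k p pN.
by ae_use (h p ((hN k).2 p pN)); apply: aeW.
Qed.

Lemma stable_finite_nonempty (Pfam N : set (V -> L0 P)) :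
  stable_finite Pfam N -> N !=set0.
Proof.
move=> [A [hA [Ns [hN ->]]]].
have /choice[qs hqs] : forall k, exists q, inseq q (Ns k).
  by move=> k; case: (Ns k) (hN k) => [[]//|p l _]; exists p; left.
have [q hq] := concat_fun_ex qs hA; exists q, qs; split=> // k.
by exists A; split=> //; exists (fun=> qs k).
Qed.

(** On each piece the sum of the absolute values over the finite list is a bound; these bounds are
    glued along the partition. *)
Lemma stable_finite_bounded (Pfam N : set (V -> L0 P)) v :
  stable_finite Pfam N -> exists u, forall q, N q -> L0le (q v) u.
Proof.
move=> [A [hA [Ns [hN ->]]]].
have /choice[us hus] : forall k, exists u : L0 P, (\forall w \ae P, 0 <= rep u w) /\
    forall p, inseq p (Ns k) -> \forall w \ae P, rep (p v) w <= rep u w.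
  move=> k; elim: (Ns k) => [|p l [u [u0 hu]]].
    by exists (L0zero P); split=> //; ae_use (rep_cst (P:=P) 0); apply: aeW => w ->.
  exists (L0add (L0abs (p v)) u); split.
    ae_use (rep_add (L0abs (p v)) u); ae_use (rep_abs (p v)); ae_use u0.
    by apply: aeW => w ? e ->; rewrite e addr_ge0.
  move=> q [<-|/hu H].
    ae_use (rep_add (L0abs (p v)) u); ae_use (rep_abs (p v)); ae_use u0.
    by apply: aeW => w ? e ->; rewrite e (le_trans (ler_norm _))// lerDl.
  ae_use (rep_add (L0abs (p v)) u); ae_use (rep_abs (p v)); ae_use H.
  by apply: aeW => w ? e ->; rewrite e (le_trans _ (_ : rep u w <= _))// lerDr.
have [u /(concatL0P _ _ hA) hu] := concatL0_ex us hA.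
exists u => q [qs [h1 h2]].
apply: (@stable_finite_transfer A Ns (fun w a _ _ => a <= rep u w) v v v hA _ q qs h1 h2).
move=> k p pN; ae_use (hu k); ae_use ((hus k).2 p pN).
by apply: aeW => w h e /e ->.
Qed.

(** Membership in [sball] requires an essential supremum: it exists because [N] is nonempty and [u]
    bounds the values, and it then lies below [u]. *)
Lemma sball_le (Pfam N : set (V -> L0 P)) x y u r : stable_finite Pfam N ->
  (forall q, N q -> L0le (q (sub x y)) u) -> L0lt u r -> sball sub N x r y.
Proof.
move=> hN hu ur; have [q Nq] := stable_finite_nonempty hN.
have [||s [[s1 s2] _]] := @L0lub_approx _ _ _ P [set p (sub x y) | p in N] u.
- by exists (q (sub x y)); exists q.
- by move=> _ [p Np <-]; exact: hu.
exists s; split=> //.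
have H : L0le s u by apply: s2 => _ [p Np <-]; exact: hu.
by ae_use H; ae_use ur; apply: aeW => w a b; exact: le_lt_trans b a.
Qed.

(** Recentres the generating balls at [z]: the new radius is [rs i] minus the supremum of [Ns i] at
    [sub (xs i) z], and the triangle inequality passes to [Ns i] pointwise. *)
Lemma Ts_nbhd_balls (Pfam : set (V -> L0 P)) z W :
  (forall p, Pfam p -> forall x y t,
     L0le (p (sub x t)) (L0add (p (sub x y)) (p (sub y t)))) ->
  Ts_nbhd sub Pfam z W ->
  exists n (Ns : 'I_n -> set (V -> L0 P)) (es : 'I_n -> L0 P),
    (forall i, stable_finite Pfam (Ns i) /\ L0pos (es i)) /\
    (forall y, (forall i, sball sub (Ns i) z (es i) y) -> W y).
Proof.
move=> tri [n [xs [Ns [rs [h hW]]]]].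
have /choice[ss hss] := fun i => (h i).2.2.
exists n, Ns, (fun i => L0sub (rs i) (ss i)); split=> [i|y hy].
  split; first exact: (h i).1.
  apply/L0pos_rep; ae_use (rep_sub (rs i) (ss i)); ae_use (hss i).2.
  by apply: aeW => w ? ->; rewrite subr_gt0.
apply: hW => i; have [s' [[s1 _] s2]] := hy i; have [[s3 _] s4] := hss i.
apply: (@sball_le Pfam _ _ _ (L0add (ss i) s') _ (h i).1).
  move=> q Nq.
  have H := @stable_finite_ind Pfam (Ns i) (fun _ a b c => a <= b + c)
    (sub (xs i) y) (sub (xs i) z) (sub z y) (h i).1 _ q Nq.
  have a1 : L0le (q (sub (xs i) z)) (ss i) by apply: s3; exists q.
  have a2 : L0le (q (sub z y)) s' by apply: s1; exists q.
  ae_use a1; ae_use a2; ae_use (rep_add (ss i) s'); refine (filter_app _ _ (H _)).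
    by apply: aeW => w ? -> ? ?; lra.
  move=> p /tri h'; ae_use (h' (xs i) z y).
  by ae_use (rep_add (p (sub (xs i) z)) (p (sub z y))); apply: aeW => w ->.
ae_use s2; ae_use (rep_add (ss i) s'); ae_use (rep_sub (rs i) (ss i)).
by apply: aeW => w -> -> ?; lra.
Qed.

End StableFamilies.

(** * A Tychonoff argument for stable families of L^0-valued functions *)

Section StableTychonoff.
Context {d : measure_display} {T : measurableType d} {R : realType}
        {P : probability T R} {X : Type}.
Implicit Types (Y C : set (X -> L0 P)) (l : seq (X * L0 P)) (r : L0 P)
  (G : set (X * L0 P)).

Local Notation stable := (stable_set (@concat_fun _ _ _ P X)).

(** Members of [C] approximate the supremum on the pieces of a partition; stability glues them into
    a single member that does so a.e. *)
Lemma stable_sup_attained C x (c : L0 P) : stable C ->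
  (forall y, C y -> L0le (y x) c) ->
  exists s, L0lub [set y x | y in C] s /\
    forall r, L0pos r -> exists y, C y /\
      \forall w \ae P, rep s w - rep r w < rep (y x) w.
Proof.
move=> [[y0 Cy0] sC] Cc.
have [||s [ls hs]] := @L0lub_approx _ _ _ P [set y x | y in C] c.
- by exists (y0 x); exists y0.
- by move=> _ [y Cy <-]; exact: Cc.
exists s; split=> // r /hs[A [ts [hA hts Ats]]].
have /choice[ys hys] : forall k, exists y, C y /\ y x = ts k.
  by move=> k; have [y Cy <-] := hts k; exists y.
have [y hy] := concat_fun_ex ys hA; exists y; split.
  by apply: (sC A ys) => // k; case: (hys k).
have H := (concatL0P _ _ hA).1 (hy x).
ae_use (ae_foralln H); ae_use (ae_foralln Ats); apply: aeW => w h1 h2.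
have [k Ak] := mpartition_cover w hA.
by rewrite (h2 k)// (hys k).2; exact: h1.
Qed.

Definition close_on l r (y : X -> L0 P) := forall e, inseq e l ->
  \forall w \ae P, `|rep (y e.1) w - rep e.2 w| < rep r w.

Lemma close_on_concat l r A ys y : mpartition A ->
  (forall k, close_on l r (ys k)) -> concat_fun A ys y -> close_on l r y.
Proof.
move=> hA hys hy e el.
have H := (concatL0P _ _ hA).1 (hy e.1).
have H' k := hys k e el.
ae_use (ae_foralln H); ae_use (ae_foralln H'); apply: aeW => w h1 h2.
by have [k Ak] := mpartition_cover w hA; rewrite (h2 k).
Qed.

Variable B : set (set (X -> L0 P)).
Hypothesis B0 : B !=set0.
Hypothesis Bstable : forall Y, B Y -> stable Y.
Hypothesis Bdir : forall Y Z, B Y -> B Z -> exists2 W, B W & W `<=` Y `&` Z.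
Hypothesis Bbound : forall x, exists c : L0 P, forall Y y, B Y -> Y y ->
  \forall w \ae P, `|rep (y x) w| <= rep c w.

(** Sets of pairs serve as graphs of partial functions: two values of [G] at one point would differ
    by less than 2r for every [r], hence coincide. *)
Definition adherent G := forall Y l r, B Y ->
  (forall e, inseq e l -> G e) -> L0pos r -> exists y, Y y /\ close_on l r y.

Lemma stable_close_on G Y l r : adherent G -> B Y ->
  (forall e, inseq e l -> G e) -> L0pos r ->
  stable (Y `&` [set y | close_on l r y]).
Proof.
move=> aG BY lG r0; split=> [|A ys hA hys y hy]; first exact: aG.
split; last by apply: (close_on_concat hA _ hy) => k; case: (hys k).
by apply: ((Bstable BY).2 A ys) => // k; case: (hys k).
Qed.

(* The new value is the limit superior of y(x) along the filter generated by
   [B] and the constraints already imposed by [G]. *)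
Lemma adherent_extend G x : adherent G -> exists v, adherent (G `|` [set (x, v)]).
Proof.
move=> aG; have [c hc] := Bbound x.
pose C Y l r : set (X -> L0 P) := Y `&` [set y | close_on l r y].
pose ok Y l r := [/\ B Y, forall e, inseq e l -> G e & L0pos r].
have Csup Y l r : ok Y l r -> exists s, L0lub [set y x | y in C Y l r] s /\
    forall r', L0pos r' -> exists y, C Y l r y /\
      \forall w \ae P, rep s w - rep r' w < rep (y x) w.
  move=> [BY lG r0]; apply: (stable_sup_attained (c:=c)).
    exact: stable_close_on aG BY lG r0.
  move=> y [Yy _]; ae_use (hc Y y BY Yy); apply: aeW => w; exact: le_trans (ler_norm _).
(* The infimum of the suprema is taken as a supremum of their negatives; hence [v'] is minus the
   limit superior. *)
pose S := [set t | exists Y l r s,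
  [/\ ok Y l r, L0lub [set y x | y in C Y l r] s & t = L0opp s]].
have [||v' [[v1 v2] v3]] := @L0lub_approx _ _ _ P S c.
- have [Y BY] := B0.
  have okY : ok Y [::] (L0one P).
    by split=> //; apply/L0pos_rep; ae_use (rep_cst (P:=P) 1); apply: aeW => w ->.
  have [s [ls _]] := Csup _ _ _ okY.
  by exists (L0opp s), Y, [::], (L0one P), s.
- move=> _ [Y [l [r [s [[BY lG r0] [s1 _] ->]]]]].
  have [y Cy] := (stable_close_on aG BY lG r0).1.
  have ys : L0le (y x) s by apply: s1; exists y.
  ae_use ys; ae_use (hc Y y BY Cy.1); ae_use (rep_opp s).
  by apply: aeW => w ->; rewrite ler_norml => /andP[]; lra.
exists (L0opp v') => Y l r BY lG r0.
(* [l'] collects constraints from [G] that account for all of [l] except the new pair. *)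
have [l' [l'G ll']] : exists l', (forall e, inseq e l' -> G e) /\
    forall e, inseq e l -> inseq e l' \/ e = (x, L0opp v').
  elim: l lG => [|e l IH] lG; first by exists [::].
  have [|l' [h1 h2]] := IH; first by move=> f fl; apply: lG; right.
  have [Ge|->] := lG e (or_introl erefl).
    exists (e :: l'); split=> f /=; first by case=> [<-|/h1].
    by case=> [->|/h2[]]; auto.
  by exists l'; split=> // f [<-|/h2]; auto.
have [r2 [r20 _ r2E]] := L0half_pos r0.
have [A [ts [hA hts Ats]]] := v3 r2 r20.
(* On piece k the constraints of [Y] and of the k-th near-optimal set are imposed together. The
   supremum over this smaller set is still at least the limit superior, so some [y] exceeds the
   limit superior minus [r2]; belonging to the k-th set, it also stays below that set's supremum,
   minus [ts k]. *)
have /choice[ys hys] : forall k, exists y, [/\ C Y l' r y,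
    \forall w \ae P, - rep v' w - rep r2 w < rep (y x) w &
    \forall w \ae P, rep (y x) w <= - rep (ts k) w].
  move=> k; have [Yk [lk [rk [s [[BYk lkG rk0] [s1 _] tsE]]]]] := hts k.
  have [Z BZ ZY] := Bdir BY BYk.
  have [m [m0 mr mrk]] := L0min_ex r0 rk0.
  have okZ : ok Z (l' ++ lk) m.
    by split=> // e /inseq_cat[]; auto.
  have [s' [ls' hs']] := Csup _ _ _ okZ.
  have [y [[Zy yc] ys']] := hs' r2 r20.
  exists y; split.
  - split; first exact: (ZY y Zy).1.
    move=> e el; ae_use (yc e ((inseq_cat _ _ _).2 (or_introl el))); ae_use mr.
    by apply: aeW => w a b; exact: lt_le_trans b a.
  - have vs : L0le (L0opp s') v' by apply: v1; exists Z, (l' ++ lk), m, s'.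
    by ae_use vs; ae_use ys'; ae_use (rep_opp s'); apply: aeW => w -> ? ?; lra.
  - have H : L0le (y x) s.
      apply: s1; exists y => //; split; first exact: (ZY y Zy).2.
      move=> e el; ae_use (yc e ((inseq_cat _ _ _).2 (or_intror el))); ae_use mrk.
      by apply: aeW => w a b; exact: lt_le_trans b a.
    rewrite tsE; ae_use H; ae_use (rep_opp s); apply: aeW => w ->; by rewrite opprK.
have [y hy] := concat_fun_ex ys hA; exists y.
have [Yy yc] : C Y l' r y.
  by apply: ((stable_close_on aG BY l'G r0).2 A ys) => // k; case: (hys k).
split=> // e /ll'[/yc//|->] /=.
have H := (concatL0P _ _ hA).1 (hy x).
have h1 k : \forall w \ae P, - rep v' w - rep r2 w < rep (ys k x) w by case: (hys k).
have h2 k : \forall w \ae P, rep (ys k x) w <= - rep (ts k) w by case: (hys k).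
ae_use (ae_foralln H); ae_use (ae_foralln h1); ae_use (ae_foralln h2).
ae_use (ae_foralln Ats); ae_use r2E; ae_use (rep_opp v').
ae_use ((L0pos_rep r).1 r0).
apply: aeW => w rp -> e2 a1 a2 a3 a4; have [k Ak] := mpartition_cover w hA.
move: (a1 k Ak) (a2 k) (a3 k); rewrite (a4 k)// ltr_norml e2 => *.
by apply/andP; split; lra.
Qed.

Lemma adherent_bigcup (F : set (set (X * L0 P))) : F `<=` adherent ->
  total_on F subset -> adherent (\bigcup_(G in F) G).
Proof.
move=> FA tF Y l r BY lF r0.
(* A finite list from the union of a chain lies in one member; the empty list is kept apart because
   the chain may be empty. *)
have : l = [::] \/ exists2 G, F G & forall e, inseq e l -> G e.
  elim: l lF => [|e l IH] lF; [by left|right].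
  have [G FG Ge] := lF e (or_introl erefl).
  have [|l0|[G' FG' lG']] := IH; first by move=> f fl; apply: lF; right.
    by exists G => // f; rewrite l0 => -[<-//|].
  have [GG'|G'G] := tF G G' FG FG'.
    by exists G' => // f [<-|/lG'//]; exact: GG'.
  by exists G => // f [<-//|/lG']; exact: G'G.
case=> [->|[G FG lG]]; last exact: (FA G FG).
by have [y Yy] := (Bstable BY).1; exists y; split=> [|e []].
Qed.

Lemma stable_tychonoff : exists phi : X -> L0 P, forall Y (l : seq X) r,
  B Y -> L0pos r -> exists y, Y y /\ forall x, inseq x l ->
    \forall w \ae P, `|rep (y x) w - rep (phi x) w| < rep r w.
Proof.
have [G [aG maxG]] := Zorn_bigcup adherent_bigcup.
have /choice[phi hphi] : forall x, exists v, G (x, v).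
  move=> x; have [v av] := adherent_extend x aG; exists v.
  (* Otherwise adding the pair would give a strictly larger adherent graph. *)
  apply: contrapT => nG; apply: (maxG _ _ av); split=> [e Ge|]; first by left.
  by move=> /(_ (x, v)) h; apply: nG; apply: h; right.
exists phi => Y l r BY r0.
have [|y [Yy yc]] := aG Y (map (fun x => (x, phi x)) l) r BY _ r0.
  by elim: l => //= x l IH e [<-|/IH].
exists y; split=> // x xl; apply: (yc (x, phi x)).
by elim: l xl {yc} => //= a l IH [->|/IH]; auto.
Qed.

End StableTychonoff.

(** * Linear functionals at most 1 on [U]: boundedness, continuity and the polar *)

Section Polar.
Context {d : measure_display} {T : measurableType d} {R : realType}
        {P : probability T R} {E : zmodType} (scale : L0 P -> E -> E)
        (Pfam : set (E -> L0 P)) (U : set E).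
Hypothesis modE : L0module scale.
Hypothesis semiP : forall p, Pfam p -> L0seminorm scale p.
Hypothesis nbhdU : Ts_nbhdE Pfam 0 U.

Lemma scale_zero r : scale r 0 = 0.
Proof.
have [_ [h _]] := modE; have := h r 0 0; rewrite addr0 => e.
by apply: (addrI (scale r 0)); rewrite addr0 -e.
Qed.

Lemma scale_opp r x : scale r (- x) = - scale r x.
Proof.
have [_ [h _]] := modE.
by apply: (addrI (scale r x)); rewrite -h !subrr scale_zero.
Qed.

Lemma nbhd0_balls : exists n (Ns : 'I_n -> set (E -> L0 P)) (es : 'I_n -> L0 P),
  (forall i, stable_finite Pfam (Ns i) /\ L0pos (es i)) /\
  (forall y, (forall i, sball (fun x y => x - y) (Ns i) 0 (es i) y) -> U y).
Proof.
apply: Ts_nbhd_balls nbhdU => p /semiP[_ [_ tri]] x y t.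
by have := tri (x - y) (y - t); rewrite addrA subrK.
Qed.

Lemma stable_finite_homog (N : set (E -> L0 P)) q r x : stable_finite Pfam N ->
  N q -> \forall w \ae P, rep (q (scale r x)) w = `|rep r w| * rep (q x) w.
Proof.
move=> hN Nq.
apply: (@stable_finite_ind _ _ _ _ _ Pfam N (fun w a b _ => a = `|rep r w| * b)
          (scale r x) x x hN _ q Nq) => p /semiP[_ [h _]].
rewrite h; ae_use (rep_mul (L0abs r) (p x)); ae_use (rep_abs r).
by apply: aeW => w e ->; rewrite e.
Qed.

Lemma nbhd0_absorbing x : exists e : L0 P, L0pos e /\
  forall r, (\forall w \ae P, `|rep r w| <= rep e w) -> U (scale r x).
Proof.
have [n [Ns [es [hN hU]]]] := nbhd0_balls.
have /choice[ts hts] := fun i => stable_finite_bounded (- x) (hN i).1.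
(* With [ts i] bounding the seminorms at [- x], the scale is [es i] over 2 (1 + |ts i|): the 1 keeps
   the denominator positive, the 2 makes the final inequality strict. The sign comes from balls
   centred at 0 measuring [0 - y]. *)
have /choice[ds hds] : forall i, exists e : L0 P, L0pos e /\
    \forall w \ae P, rep e w * (2 * (1 + `|rep (ts i) w|)) = rep (es i) w.
  move=> i; pose a := L0mul (L0cst P 2) (L0add (L0one P) (L0abs (ts i))).
  have aE : \forall w \ae P, rep a w = 2 * (1 + `|rep (ts i) w|).
    ae_use (rep_mul (L0cst P 2) (L0add (L0one P) (L0abs (ts i)))).
    ae_use (rep_add (L0one P) (L0abs (ts i))); ae_use (rep_abs (ts i)).
    ae_use (rep_cst (P:=P) 2); ae_use (rep_cst (P:=P) 1).
    by apply: aeW => w e1 e2 e3 e4 e5; rewrite e5 e2 e4 e1 e3.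
  have a0 : L0pos a.
    apply/L0pos_rep; ae_use aE; apply: aeW => w ->.
    by have := normr_ge0 (rep (ts i) w); lra.
  have [b [b0 bE]] := L0inv_ex a0.
  exists (L0mul (es i) b); split.
    apply/L0pos_rep; ae_use (rep_mul (es i) b); ae_use ((L0pos_rep _).1 b0).
    by ae_use ((L0pos_rep _).1 (hN i).2); apply: aeW => w ? ? ->; rewrite mulr_gt0.
  ae_use (rep_mul (es i) b); ae_use bE; ae_use aE; ae_use ((L0pos_rep _).1 a0).
  by apply: aeW => w p e1 e2 ->; rewrite e2 -e1 mulfVK// gt_eqF.
have [e [e0 he]] := L0min_fin_ex (fun i => (hds i).1).
exists e; split=> // r re; apply: hU => i.
have [h [_ hlt hE]] := L0half_pos (hN i).2.
apply: (sball_le (hN i).1 _ hlt) => q Nq; rewrite sub0r -scale_opp.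
ae_use (stable_finite_homog r (- x) (hN i).1 Nq); ae_use re; ae_use (he i).
ae_use (hds i).2; ae_use (hts i q Nq); ae_use hE; ae_use ((L0pos_rep _).1 (hds i).1).
apply: aeW => w d0 -> qt <- h1 h2 ->.
apply: (@le_trans _ _ (`|rep r w| * (1 + `|rep (ts i) w|))).
  by rewrite ler_wpM2l// (le_trans qt)// (le_trans (ler_norm _))// lerDr.
rewrite mulrCA mulrAC mulrA divff// mul1r.
by rewrite ler_wpM2r// ?addr_ge0//; exact: le_trans h2 h1.
Qed.

Definition L0linear (f : E -> L0 P) :=
  (forall x y, f (x + y) = L0add (f x) (f y)) /\
  (forall r x, f (scale r x) = L0mul r (f x)).

(** Since [U] contains both e x and -e x, the bound 1 on [U] gives |f x| <= 1/e, where e depends on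
    [x] alone. *)
Lemma linear_le1_bounded x : exists c : L0 P, forall f, L0linear f ->
  (forall z, U z -> L0le (f z) (L0one P)) ->
  \forall w \ae P, `|rep (f x) w| <= rep c w.
Proof.
have [e [e0 he]] := nbhd0_absorbing x.
have [c [c0 cE]] := L0inv_ex e0; exists c => f [_ fM] fU.
have ep := (L0pos_rep _).1 e0.
have U1 : U (scale e x) by apply: he; ae_use ep; apply: aeW => w ?; rewrite gtr0_norm.
have U2 : U (scale (L0opp e) x).
  apply: he; ae_use ep; ae_use (rep_opp e); apply: aeW => w -> ?.
  by rewrite normrN gtr0_norm.
have := (L0le1_rep _).1 (fU _ U1); have := (L0le1_rep _).1 (fU _ U2).
rewrite !fM => H2 H1; ae_use H1; ae_use H2; ae_use (rep_mul e (f x)).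
ae_use (rep_mul (L0opp e) (f x)); ae_use (rep_opp e); ae_use cE; ae_use ep.
apply: aeW => w p -> e1 -> -> ; rewrite e1 => h1 h2.
rewrite -[leRHS]mul1r ler_pdivlMr// mulrC -[X in X * _](gtr0_norm p) -normrM ler_norml.
by apply/andP; split; lra.
Qed.

Lemma linear_le1_continuous (f : E -> L0 P) : L0linear f ->
  (forall z, U z -> L0le (f z) (L0one P)) ->
  forall x W, nbhdL0 (f x) W -> Ts_nbhdE Pfam x (f @^-1` W).
Proof.
move=> [fD fM] fU x W [t [r [r0 [ltr hW]]]].
have [n [Ns [es [hN hU]]]] := nbhd0_balls.
(* [g] is the room left around [f x] inside the ball about [t], and [h] is half of it. If [y] is
   within [h * es i] of [x] for every i, then (y - x)/h and its negative lie in [U], so |f y - f x|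
   <= h < g. *)
pose g := L0sub r (L0abs (L0sub (f x) t)).
have gE : \forall w \ae P, rep g w = rep r w - `|rep (f x) w - rep t w|.
  ae_use (rep_sub r (L0abs (L0sub (f x) t))); ae_use (rep_abs (L0sub (f x) t)).
  by ae_use (rep_sub (f x) t); apply: aeW => w e1 e2 e3; rewrite e3 e2 e1.
have g0 : L0pos g.
  apply/L0pos_rep; ae_use gE; ae_use ltr; ae_use (rep_abs (L0sub (f x) t)).
  by ae_use (rep_sub (f x) t); apply: aeW => w e1 -> ? ->; rewrite subr_gt0 -e1.
have [h [h0 _ hE]] := L0half_pos g0.
have [k [k0 kE]] := L0inv_ex h0.
have hp := (L0pos_rep _).1 h0; have kp := (L0pos_rep _).1 k0.
exists n, (fun=> x), Ns, (fun i => L0mul h (es i)); split=> [i|y hy].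
  have rp : L0pos (L0mul h (es i)).
    apply/L0pos_rep; ae_use (rep_mul h (es i)); ae_use hp.
    by ae_use ((L0pos_rep _).1 (hN i).2); apply: aeW => w ? ? ->; rewrite mulr_gt0.
  split; first exact: (hN i).1.
  split=> //; apply: (sball_le (u:=L0zero P) (hN i).1) => // q Nq.
  have := stable_finite_homog (L0zero P) 0 (hN i).1 Nq.
  rewrite scale_zero subrr => H; ae_use H; ae_use (rep_cst (P:=P) 0).
  by apply: aeW => w e; rewrite e normr0 mul0r => ->.
(* Stated for every [s] of modulus 1/h so that [k] and its negative yield the two sides of the
   estimate. *)
have key (s : L0 P) : (\forall w \ae P, `|rep s w| = rep k w) ->
    \forall w \ae P, rep s w * (rep (f y) w - rep (f x) w) <= 1.
  move=> sk; have : U (scale s (y - x)).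
    apply: hU => i; have [u [[u1 _] u2]] := hy i.
    apply: (sball_le (u:=L0mul k u) (hN i).1).
      move=> q Nq; rewrite sub0r -scale_opp opprB.
      have uq : L0le (q (x - y)) u by apply: u1; exists q.
      ae_use (stable_finite_homog s (x - y) (hN i).1 Nq); ae_use sk; ae_use uq.
      ae_use (rep_mul k u); ae_use kp; apply: aeW => w ? -> ? e ->.
      by rewrite e ler_wpM2l// ltW.
    ae_use u2; ae_use (rep_mul h (es i)); ae_use (rep_mul k u); ae_use kE; ae_use hp.
    by apply: aeW => w p e -> -> ?; rewrite e mulrC ltr_pdivrMr// mulrC.
  move=> /fU/L0le1_rep; rewrite fM => H.
  have fyE : f y = L0add (f (y - x)) (f x) by rewrite -fD subrK.
  ae_use H; ae_use (rep_mul s (f (y - x))); ae_use (rep_add (f (y - x)) (f x)).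
  by apply: aeW => w; rewrite -fyE => -> ->; rewrite addrK.
apply: hW => /=.
have K1 : \forall w \ae P, rep k w * (rep (f y) w - rep (f x) w) <= 1.
  by apply: key; ae_use kp; apply: aeW => w ?; rewrite gtr0_norm.
have K2 : \forall w \ae P, rep (L0opp k) w * (rep (f y) w - rep (f x) w) <= 1.
  apply: key; ae_use kp; ae_use (rep_opp k); apply: aeW => w -> ?.
  by rewrite normrN gtr0_norm.
ae_use K1; ae_use K2; ae_use (rep_opp k); ae_use kE; ae_use hp; ae_use hE; ae_use gE.
ae_use (rep_abs (L0sub (f y) t)); ae_use (rep_sub (f y) t); ae_use ((L0pos_rep _).1 g0).
apply: aeW => w gp -> -> e1 e2 p e3 -> {K1 K2}.
rewrite e3 mulNr [_^-1 * _]mulrC -mulNr !ler_pdivrMr// !mul1r => h1 h2.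
have := ler_normD (rep (f y) w - rep (f x) w) (rep (f x) w - rep t w).
have : `|rep (f y) w - rep (f x) w| <= rep h w by rewrite ler_norml; apply/andP; split; lra.
by rewrite addrA subrK; lra.
Qed.

Lemma polarP f : L0polar scale Pfam U f <->
  L0linear f /\ forall z, U z -> L0le (f z) (L0one P).
Proof.
split=> [[[fD [fM _]] fU]|[lf fU]]; first by split.
split=> //; split; first exact: lf.1.
by split; [exact: lf.2|exact: linear_le1_continuous].
Qed.

Lemma stable_polar : stable_set (@concat_fun _ _ _ P E) (L0polar scale Pfam U).
Proof.
split.
  exists (fun=> L0zero P); apply/polarP; split; first split=> [x y|r x].
  - apply: L0eqP; ae_use (rep_add (L0zero P) (L0zero P)); ae_use (rep_cst (P:=P) 0).
    by apply: aeW => w e1 ->; rewrite e1 addr0.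
  - apply: L0eqP; ae_use (rep_mul r (L0zero P)); ae_use (rep_cst (P:=P) 0).
    by apply: aeW => w e1 ->; rewrite e1 mulr0.
  - move=> z _; apply/L0le1_rep; ae_use (rep_cst (P:=P) 0).
    by apply: aeW => w ->.
move=> A fs hA hfs f hf.
have lfs k := (polarP (fs k)).1 (hfs k).
have H x := ae_foralln ((concatL0P _ _ hA).1 (hf x)).
apply/polarP; split; first split=> [x y|r x].
- have K k : \forall w \ae P, rep (fs k (x + y)) w = rep (fs k x) w + rep (fs k y) w.
    by rewrite (lfs k).1.1; exact: rep_add.
  apply: L0eqP; ae_use (H (x + y)); ae_use (H x); ae_use (H y).
  ae_use (rep_add (f x) (f y)); ae_use (ae_foralln K); apply: aeW => w h -> e1 e2 e3.
  have [k Ak] := mpartition_cover w hA.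
  by rewrite (e1 k)// (e2 k)// (e3 k).
- have K k : \forall w \ae P, rep (fs k (scale r x)) w = rep r w * rep (fs k x) w.
    by rewrite (lfs k).1.2; exact: rep_mul.
  apply: L0eqP; ae_use (H (scale r x)); ae_use (H x).
  ae_use (rep_mul r (f x)); ae_use (ae_foralln K); apply: aeW => w h -> e1 e2.
  have [k Ak] := mpartition_cover w hA.
  by rewrite (e1 k)// (e2 k).
- move=> z Uz; have K k : L0le (fs k z) (L0one P) by exact: (lfs k).2.
  ae_use (H z); ae_use (ae_foralln K); apply: aeW => w h e.
  by have [k Ak] := mpartition_cover w hA; rewrite (e k).
Qed.

(** Additivity, homogeneity and the bound at [z] each involve finitely many points, so a member of
    the polar close to [phi] there verifies them up to an arbitrary error. *)
Lemma polar_adherent (phi : E -> L0 P) :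
  (forall (l : seq E) (r : L0 P), L0pos r -> exists y, L0polar scale Pfam U y /\
     forall x, inseq x l -> \forall w \ae P, `|rep (y x) w - rep (phi x) w| < rep r w) ->
  L0polar scale Pfam U phi.
Proof.
move=> h.
have cp (e : R) : 0 < e -> L0pos (L0cst P e).
  by move=> e0; apply/L0pos_rep; ae_use (rep_cst (P:=P) e); apply: aeW => w ->.
apply/polarP; split; first split=> [x y|r x].
(* One third of the error for each of [x], [y] and [x + y]. *)
- apply: L0eq_eps => e e0; have e3 : 0 < e / 3 by lra.
  have [f [/polarP[[fD _] _] hf]] := h [:: x; y; x + y] _ (cp _ e3).
  have Hx := hf x (or_introl erefl).
  have Hy := hf y (or_intror (or_introl erefl)).
  have Hxy := hf (x + y) (or_intror (or_intror (or_introl erefl))).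
  rewrite fD in Hxy; ae_use Hx; ae_use Hy; ae_use Hxy; ae_use (rep_cst (P:=P) (e / 3)).
  ae_use (rep_add (f x) (f y)); ae_use (rep_add (phi x) (phi y)).
  apply: aeW => w -> -> ->; rewrite !ltr_norml ler_norml.
  move=> /andP[? ?] /andP[? ?] /andP[? ?]; by apply/andP; split; lra.
- apply: L0eq_eps => e e0.
  (* Tolerance e/(1+|r|): the error at [scale r x] and |r| times the error at [x] then add up to at
     most e. *)
  pose b := L0add (L0one P) (L0abs r).
  have bE : \forall w \ae P, rep b w = 1 + `|rep r w|.
    ae_use (rep_add (L0one P) (L0abs r)); ae_use (rep_abs r); ae_use (rep_cst (P:=P) 1).
    by apply: aeW => w e1 e2 e3; rewrite e3 e2 e1.
  have b0 : L0pos b.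
    by apply/L0pos_rep; ae_use bE; apply: aeW => w ->; rewrite ltr_pwDl.
  have [c [c0 cE]] := L0inv_ex b0.
  have ec0 : L0pos (L0mul (L0cst P e) c).
    apply/L0pos_rep; ae_use (rep_mul (L0cst P e) c); ae_use ((L0pos_rep _).1 c0).
    by ae_use (rep_cst (P:=P) e); apply: aeW => w -> ? ->; rewrite mulr_gt0.
  have [f [/polarP[[_ fM] _] hf]] := h [:: x; scale r x] _ ec0.
  have H1 := hf x (or_introl erefl).
  have H2 := hf (scale r x) (or_intror (or_introl erefl)).
  rewrite fM in H2; ae_use H1; ae_use H2; ae_use (rep_mul (L0cst P e) c).
  ae_use (rep_cst (P:=P) e); ae_use cE; ae_use bE.
  ae_use (rep_mul r (f x)); ae_use (rep_mul r (phi x)).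
  apply: aeW => w -> -> e1 e2 e3 ->; rewrite e3 e2 e1 => {H1 H2}.
  set D := _ / _ => h2 h1.
  have D1 : D * (1 + `|rep r w|) = e by rewrite /D mulfVK// gt_eqF// ltr_pwDl.
  have -> : rep (phi (scale r x)) w - rep r w * rep (phi x) w =
     rep r w * (rep (f x) w - rep (phi x) w) -
     (rep r w * rep (f x) w - rep (phi (scale r x)) w) by lra.
  apply: (le_trans (ler_normB _ _)); rewrite normrM -D1 mulrDr mulr1 addrC.
  by apply: lerD; [exact: ltW|rewrite mulrC ler_wpM2r// ltW].
- move=> z Uz; apply: L0le_eps => e e0.
  have [f [/polarP[_ fU] hf]] := h [:: z] _ (cp _ e0).
  have H := hf z (or_introl erefl).
  ae_use H; ae_use (fU z Uz); ae_use (rep_cst (P:=P) e); apply: aeW => w -> ?.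
  by rewrite ltr_norml => /andP[? ?]; lra.
Qed.

End Polar.

(** * From closeness at finitely many points to weak neighbourhoods *)

Section WeakCluster.
Context {d : measure_display} {T : measurableType d} {R : realType}
        {P : probability T R}.

(** The cells of the common refinement are indexed by functions choosing one piece from each
    partition; there are countably many, so they can be coded by numbers. *)
Lemma mpartition_refine n (As : 'I_n -> nat -> set T) :
  (forall i, mpartition (As i)) ->
  exists A (g : nat -> 'I_n -> nat), mpartition A /\
    forall m, \forall w \ae P, A m w -> forall i, As i (g m i) w.
Proof.
move=> hAs.
pose g m : 'I_n -> nat := if unpickle m is Some f then (f : {ffun 'I_n -> nat}) else fun=> 0%N.
have [||A [hA AD]] := @mpartition_of_ae_cover _ _ _ P
    (fun m => \bigcap_(i in [set: 'I_n]) As i (g m i)).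
- by move=> m; apply: fin_bigcap_measurable => // i _; case: (hAs i).
- apply: aeW => w.
  have /choice[f hf] := fun i => mpartition_cover w (hAs i).
  by exists (pickle [ffun i => f i]) => i _; rewrite /g pickleK ffunE.
exists A, g; split=> // m; ae_use (AD m); apply: aeW => w h /h.
by move=> h' i; exact: h'.
Qed.

Lemma inseq_bigcat (X : Type) n (ls : 'I_n -> seq X) :
  exists l, forall i x, inseq x (ls i) -> inseq x l.
Proof.
elim: n ls => [|n IH] ls; first by exists [::] => -[].
have [l hl] := IH (fun i => ls (lift ord0 i)).
exists (ls ord0 ++ l) => i x; case: (unliftP ord0 i) => [j|] -> h; apply/inseq_cat.
  by right; exact: hl h.
by left.
Qed.

Lemma weak_list_points (X : zmodType) (L : seq ((X -> L0 P) -> L0 P)) :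
  (forall q, inseq q L -> weak_family q) ->
  exists l : seq X, forall q, inseq q L ->
    exists2 x, inseq x l & q = fun f => L0abs (f x).
Proof.
elim: L => [|q L IH] h; first by exists [::].
have [|l hl] := IH; first by move=> p pL; apply: h; right.
have [x qx] := h q (or_introl erefl).
exists (x :: l) => p [<-|/hl[y yl ->]]; first by exists x => //; left.
by exists y => //; right.
Qed.

Lemma sigma_nbhd_meets (X : zmodType) (Y : set (X -> L0 P)) (phi : X -> L0 P) W :
  stable_set (@concat_fun _ _ _ P X) Y ->
  (forall (l : seq X) (r : L0 P), L0pos r -> exists y, Y y /\ forall x, inseq x l ->
    \forall w \ae P, `|rep (y x) w - rep (phi x) w| < rep r w) ->
  nbhd_sigma phi W -> exists y, Y y /\ W y.
Proof.
move=> [_ sY] hphi nW.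
have [|n [Ns [es [hN hW]]]] := Ts_nbhd_balls _ nW.
  move=> _ [x ->] f g h /=.
  ae_use (rep_add (L0abs (L0sub (f x) (g x))) (L0abs (L0sub (g x) (h x)))).
  ae_use (rep_abs (L0sub (f x) (h x))); ae_use (rep_abs (L0sub (f x) (g x))).
  ae_use (rep_abs (L0sub (g x) (h x))); ae_use (rep_sub (f x) (h x)).
  ae_use (rep_sub (f x) (g x)); ae_use (rep_sub (g x) (h x)).
  apply: aeW => w e1 e2 e3 e4 e5 e6 e7; rewrite e7 e6 e5 e4 e3 e2 e1.
  exact: ler_distD.
have [e [e0 he]] := L0min_fin_ex (fun i => (hN i).2).
have [r [r0 re _]] := L0half_pos e0.
have /choice[As hAs] := fun i => (hN i).1.
have /choice[Ls hLs] := fun i => (hAs i).2.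
have [A [g [hA Ag]]] := mpartition_refine (fun i => (hAs i).1).
have /choice[pts hpts] : forall ik : 'I_n * nat, exists l : seq X,
    forall q, inseq q (Ls ik.1 ik.2) -> exists2 x, inseq x l & q = fun f => L0abs (f x).
  by move=> [i k]; apply: weak_list_points => q; exact: ((hLs i).1 k).2.
(* On one cell of the refinement only finitely many evaluation points matter for all i, so a single
   member of [Y] is close to [phi] at all of them; these members are then glued. *)
have /choice[ys hys] : forall m, exists y, Y y /\ forall i x, inseq x (pts (i, g m i)) ->
    \forall w \ae P, `|rep (y x) w - rep (phi x) w| < rep r w.
  move=> m; have [l hl] := inseq_bigcat (fun i => pts (i, g m i)).
  have [y [Yy hy]] := hphi l r r0.
  by exists y; split=> // i x /hl; exact: hy.
have [y hy] := concat_fun_ex ys hA; exists y; split.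
  by apply: (sY A ys) => // m; case: (hys m).
apply: hW => i; apply: (sball_le (u:=r) (hN i).1); last first.
  by ae_use re; ae_use (he i); apply: aeW => w a b; exact: lt_le_trans b a.
rewrite (hLs i).2 => q [qs [h1 h2]].
pose z := fun x => L0sub (phi x) (y x).
apply: (@stable_finite_transfer _ _ _ _ _ _ _ (fun w a _ _ => a <= rep r w) z z z
  (hAs i).1 _ q qs h1 h2) => k p /(hpts (i, k))[x xl ->].
(* The equation is a guard: at a point of [A m] lying in [As i k], disjointness forces
   [g m i = k]. *)
have K m : \forall w \ae P, g m i = k -> `|rep (ys m x) w - rep (phi x) w| < rep r w.
  have [gk|gk] := pselect (g m i = k); last by apply: aeW.
  have [_ /(_ i x)] := hys m; rewrite gk => /(_ xl) H.
  by ae_use H; apply: aeW.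
ae_use (ae_foralln K); ae_use (ae_foralln Ag).
ae_use (ae_foralln ((concatL0P _ _ hA).1 (hy x))).
ae_use (rep_abs (z x)); ae_use (rep_sub (phi x) (y x)).
apply: aeW => w e1 e2 e3 e4 e5 Aik; have [m Am] := mpartition_cover w hA.
rewrite e2 e1 (e3 m)// distrC ltW// e5//.
exact: mpartition_inj (hAs i).1 (e4 m Am i) Aik.
Qed.

End WeakCluster.

Theorem theorem6 (d : measure_display) (T : measurableType d) (R : realType)
  (P : probability T R) (E : zmodType) (scale : L0 P -> E -> E)
  (Pfam : set (E -> L0 P)) (U : set E) :
  L0module scale -> stable_module scale ->
  (forall p, Pfam p -> L0seminorm scale p) ->
  L0stable_family Pfam -> L0separated Pfam ->
  stable_set (concatE scale) U -> Ts_nbhdE Pfam 0 U ->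
  stable_compact (@concat_fun _ _ _ P E) (nbhd_sigma (E:=E))
    (L0polar scale Pfam U).
Proof.
move=> modE _ semiP _ _ _ nbhdU; split; first exact: stable_polar.
move=> F [FK [_ [_ [FI _]]]] [B [BF [FB [B0 [Bs _]]]]].
have [||phi hphi] := stable_tychonoff B0 Bs.
(* The base is directed: the filter contains the intersection, which contains a base set. *)
- move=> Y Z /BF FY /BF FZ; have [W BW WYZ] := FB _ (FI _ _ FY FZ).
  by exists W.
- move=> x; have [c hc] := linear_le1_bounded modE semiP nbhdU x.
  exists c => Y y /BF/FK YK /YK[[fD [fM _]] fU]; exact: hc.
exists phi; split=> [|G W FG]; last first.
  have [Y BY YG] := FB G FG => hW.
  have [y [Yy Wy]] := sigma_nbhd_meets (Bs Y BY) (fun l r => hphi Y l r BY) hW.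
  by exists y; split=> //; exact: YG.
(* Any base set lies inside the polar, so [phi] is approximated at finitely many points by members
   of the polar. *)
have [Y BY] := B0; apply: (polar_adherent modE semiP nbhdU) => l r r0.
have [y [Yy hy]] := hphi Y l r BY r0; exists y; split=> //.
exact: FK (BF _ BY) _ Yy.
Qed.
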